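(* Suppose that $f_2,\ldots,f_N$ are strongly convex with convexity parameters $\sigma_2,\ldots,\sigma_N>0$, that each $\nabla f_i$ ($i=1,\ldots,N$) is Lipschitz continuous with constant $L_i$ (in particular there are no constraints, i.e. $\mathcal{X}_i=\mathbf{R}^{n_i}$ for all $i$), and that $A_1$ has full column rank. Let $(x_1^*,\ldots,x_N^*,\lambda^* )\in\Omega^*$. If $\gamma>0$ satisfies $$\gamma < \min_{i=2,\ldots, N-1}\left\{\frac{4\sigma_{i}}{3(2N-i)(i-1)\lambda_{\max}(A_{i}^\top A_{i})},\ \frac{4\sigma_{N}}{(3N^2-3N-2)\lambda_{\max}(A_{N}^\top A_{N})}\right\},$$ then the sequence generated by the $N$-block ADMM satisfies $$\gamma\sum_{i=1}^{N-1}\Big\| \sum_{j=i+1}^{N}A_{j}(x_{j}^{*}-x_{j}^{k})\Big\|^{2}+\frac{1}{2\gamma}\|\lambda^*-\lambda^{k}\|^{2}\ \geq\ (1+\delta_6)\left(\gamma\sum_{i=1}^{N-1}\Big\| \sum_{j=i+1}^{N}A_{j}(x_{j}^{*}-x_{j}^{k+1})\Big\|^{2}+\frac{1}{2\gamma}\|\lambda^*-\lambda^{k+1}\|^{2}\right),$$ where $$\delta_6 := \min\left\{\frac{\gamma^2}{4\kappa \gamma^2(N-1)\lambda_{\max}(A_{1}^{\top}A_{1})+ 4\kappa L_{1}^2\lambda_{\min}^{-1}(A_{1}^{\top}A_{1})},\ \delta_3,\ \delta_4,\ \delta_5\right\}$$ and $$\delta_3 := \min_{i=2,\ldots,N-1}\left\{\frac{4\sigma_i\gamma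 - 3\gamma^2 (2N-i)(i-1)\lambda_{\max}(A_i^\top A_i)}{2\gamma^2(2N-i)(i-1)\lambda_{\max}(A_i^\top A_i) + 4\kappa L_i^2}\right\},\qquad \delta_4 := \min_{i=1,\ldots,N-1}\left\{\frac{1}{4\kappa \lambda_{\max}(A_{i}^{\top}A_{i})}\right\},$$ $$\delta_5 := \frac{4\sigma_N\gamma-(3N^2-3N-2)\gamma^2\lambda_{\max}(A_N^\top A_N)}{2\gamma^2 N(N-1)\lambda_{\max}(A_N^\top A_N)+4\kappa L_N^2}.$$ The bound on $\gamma$ implies $\delta_6>0$. As a result, $$\Big(\sum_{j=2}^{N}A_{j}x_{j}^{k},\ \sum_{j=3}^{N}A_{j}x_{j}^{k},\ \ldots,\ \sum_{j=N}^{N}A_{j}x_{j}^{k},\ \lambda^k\Big)$$ converges $Q$-linearly.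
   Context: Setting. $N\ge 3$; $A_i\in\mathbf{R}^{p\times n_i}$, $b\in\mathbf{R}^p$; $\mathcal{X}_i\subset\mathbf{R}^{n_i}$ are closed convex sets and $\tilde f_i:\mathbf{R}^{n_i}\to\mathbf{R}$ are closed convex functions ($i=1,\ldots,N$). Put $f_i:=\tilde f_i+\mathbf{1}_i$, where $\mathbf{1}_i$ is $0$ on $\mathcal{X}_i$ and $+\infty$ outside. The problem is $\min \sum_{i=1}^N f_i(x_i)$ subject to $\sum_{i=1}^N A_ix_i=b$. $\Omega^*$ is the set of primal-dual optimal solutions, i.e. of $(x_1^*,\ldots,x_N^*,\lambda^* )$ with $A_i^\top\lambda^*\in\partial f_i(x_i^* )$ for $i=1,\ldots,N$ and $\sum_{i=1}^NA_ix_i^*=b$. It is assumed throughout that $\Omega^*\neq\emptyset$. Augmented Lagrangian, with penalty parameter $\gamma>0$: $\mathcal{L}_\gamma(x_1,\ldots,x_N;\lambda)=\sum_i f_i(x_i)-\langle\lambda,\sum_iA_ix_i-b\rangle+\frac{\gamma}{2}\|\sum_iA_ix_i-b\|^2$. $N$-block ADMM: given $(x_2^k,\ldots,x_N^k;\lambda^k)$, for successively $i=1,\ldots,N$ set $x_i^{k+1}:=\operatorname{argmin}_{x_i}\mathcal{L}_\gamma(x_1^{k+1},\ldots,x_{i-1}^{k+1},x_i,x_{i+1}^k,\ldots,x_N^k;\lambda^k)$, and then $\lambda^{k+1}:=\lambda^k-\gamma(\sum_{i=1}^NA_ix_i^{k+1}-b)$. The convexity parameter $\sigma_i$ of $f_i$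 satisfies $(x-y)^\top(g_i(x)-g_i(y))\ge\sigma_i\|x-y\|^2$ for all $x,y\in\mathcal{X}_i$, where $g_i(x)\in\partial f_i(x)$ and $g_i(y)\in\partial f_i(y)$ are subgradients; $f_i$ is strongly convex if and only if $\sigma_i>0$. $\|\cdot\|$ is the Euclidean norm; $\lambda_{\max}(B),\lambda_{\min}(B)$ are the largest and smallest eigenvalues of a real symmetric matrix $B$, and $\lambda_{\min}^{-1}(B)=1/\lambda_{\min}(B)$. Constant $\kappa>0$. Write $A=[A_1,\ldots,A_N]$, a matrix with $p$ rows. (i) If $A$ has full row rank, $\kappa:=\lambda_{\min}^{-1}(AA^\top)$. (ii) Otherwise let $r=\mathrm{rank}(A)<p$; without loss of generality the first $r$ rows of $A$, forming $A^r=[A_1^r,\ldots,A_N^r]$, are linearly independent, and $A=\begin{pmatrix} I\\ B\end{pmatrix}A^r$ with $I\in\mathbf{R}^{r\times r}$ the identity and $B\in\mathbf{R}^{(p-r)\times r}$. Put $E:=(I+B^\top B)A^r$ (which has full row rank) and $\kappa:=\lambda_{\min}^{-1}(EE^\top)\,\lambda_{\max}(I+B^\top B)$. The minimum bounding $\gamma$ is over all the ratios with $i=2,\ldots,N-1$ together with the last listed ratio. $Q$-linear convergence of a sequence $u^k$ to $u^*$: for some norm (here $|(w_1,\ldots,w_{N-1},\lambda)|^2=\gamma\sum_{i=1}^{N-1}\|w_i\|^2+\frac1{2\gamma}\|\lambda\|^2$) there is $\rho\in(0,1)$ with $|u^{k+1}-u^*|\le\rho|u^k-u^*|$ for all $k$;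 here the limit is the tuple obtained by replacing $x_j^k,\lambda^k$ by $x_j^*,\lambda^*$.
   Formalization: When A lacks full row rank, the formal theorem additionally assumes that λ* − λ⁰ lies in the range of A; without this the claim fails, e.g. x⁰ = x*, λ⁰ = λ* + z with 0 ≠ z in ker Aᵀ gives a constant sequence. *)

(* Defs.v *)
From HB Require Import structures.
From mathcomp Require Import all_boot all_order all_algebra.
From mathcomp Require Import perm.
From mathcomp Require Import all_classical all_reals all_analysis.

Set Implicit Arguments.
Unset Strict Implicit.
Unset Printing Implicit Defensive.

Import Order.TTheory GRing.Theory Num.Theory.
Import numFieldNormedType.Exports.

Local Open Scope classical_set_scope.
Local Open Scope ring_scope.

(* The library norm on matrices is the sup norm; it only supplies the topology
   (closed sets, differentiability). All quantitative statements use the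
   Euclidean norm [enorm]. *)
Section Euclidean.
Context {R : realType}.

Definition dotv n (u v : 'cV[R]_n) : R := (u^T *m v) 0 0.

Definition enorm n (u : 'cV[R]_n) : R := Num.sqrt (dotv u u).

(* Used on real symmetric matrices of positive size, whose set of eigenvalues
   is finite and nonempty, so that sup and inf are attained. *)
Definition lambda_max n (B : 'M[R]_n) : R := sup [set a | eigenvalue B a].

Definition lambda_min n (B : 'M[R]_n) : R := inf [set a | eigenvalue B a].

Definition gradient n (f : 'cV[R]_n -> R) (x : 'cV[R]_n) : 'cV[R]_n :=
  \col_j 'D_(delta_mx j 0) f x.

End Euclidean.

Section ConvexAnalysis.
Context {R : realType} {n : nat}.

Definition closed_function (f : 'cV[R]_n -> R) : Prop :=
  closed [set z : 'cV[R]_n * R | f z.1 <= z.2].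

Definition indic_infty (X : set 'cV[R]_n) (x : 'cV[R]_n) : \bar R :=
  if x \in X then 0%E else +oo%E.

Definition restricted (f : 'cV[R]_n -> R) (X : set 'cV[R]_n) :
    'cV[R]_n -> \bar R :=
  fun x => ((f x)%:E + indic_infty X x)%E.

Definition subdifferential (f : 'cV[R]_n -> \bar R) (x : 'cV[R]_n) :
    set 'cV[R]_n :=
  [set g | f x \is a fin_num /\
           forall y, (f x + (dotv g (y - x))%:E <= f y)%E].

Definition convexity_parameter (X : set 'cV[R]_n) (f : 'cV[R]_n -> \bar R)
    (sigma : R) : Prop :=
  forall x y gx gy, X x -> X y ->
    subdifferential f x gx -> subdifferential f y gy ->
    sigma * enorm (x - y) ^+ 2 <= dotv (x - y) (gx - gy).

(* Finiteness everywhere makes the gradient of an extended-valued [f] meaningful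
   on the whole space; for [f = restricted g X] it says that [X = setT]. *)
Definition lipschitz_gradient (f : 'cV[R]_n -> \bar R) (L : R) : Prop :=
  [/\ forall x, f x \is a fin_num,
      forall x, differentiable (fine \o f) x &
      forall x y, enorm (gradient (fine \o f) x - gradient (fine \o f) y)
                    <= L * enorm (x - y)].

End ConvexAnalysis.

(* [u k] converges Q-linearly to [l] for the norm [nrm]. *)
Definition Q_linear {R : realType} (V : zmodType) (nrm : V -> R)
    (u : nat -> V) (l : V) : Prop :=
  exists2 rho : R, 0 < rho < 1 & forall k, nrm (u k.+1 - l) <= rho * nrm (u k - l).

(* Blocks are indexed by ['I_N]: the ordinal [i] is the block numbered [i.+1]
   in the mathematical text, where blocks run from 1 to N. *)
Lemma last_block_subproof N (hN : (3 <= N)%N) : (N.-1 < N)%N.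
Proof. by rewrite ltn_predL (ltn_trans _ hN). Qed.

Definition first_block N (hN : (3 <= N)%N) : 'I_N := Ordinal (ltnW (ltnW hN)).
Definition last_block N (hN : (3 <= N)%N) : 'I_N :=
  Ordinal (last_block_subproof hN).

Section ADMM.
Context {R : realType} {N p : nat} {n : 'I_N -> nat}.
Variables (A : forall i, 'M[R]_(p, n i)) (b : 'cV[R]_p).
Variable f : forall i, 'cV[R]_(n i) -> \bar R.
Arguments f : clear implicits.
Implicit Types (x : forall i, 'cV[R]_(n i)) (lam : 'cV[R]_p).

Definition full_matrix : 'M[R]_(p, \sum_i n i) := \mxrow_(i < N) A i.

Definition residual x : 'cV[R]_p := \sum_(i < N) A i *m x i - b.

Definition primal_dual_optimal x lam : Prop :=
  (forall i, subdifferential (f i) (x i) ((A i)^T *m lam)) /\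
  \sum_(i < N) A i *m x i = b.

Definition aug_lagrangian (gamma : R) x lam : \bar R :=
  (\sum_(i < N) f i (x i) +
   (- dotv lam (residual x) + gamma / 2 * enorm (residual x) ^+ 2)%R%:E)%E.

(* Before block [i] is updated, the blocks below [i] are already new; the entry
   at [i] itself is overwritten by [dfwith] below. *)
Definition admm_point (xnew xold : forall i, 'cV[R]_(n i)) (i : 'I_N) :
    forall j, 'cV[R]_(n j) :=
  fun j => if (j < i)%N then xnew j else xold j.

Definition admm_sequence (gamma : R) (x : nat -> forall i, 'cV[R]_(n i))
    (lam : nat -> 'cV[R]_p) : Prop :=
  forall k,
    (forall (i : 'I_N) (y : 'cV[R]_(n i)),
       (aug_lagrangian gamma (dfwith (admm_point (x k.+1) (x k) i) i (x k.+1 i))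
          (lam k)
        <= aug_lagrangian gamma (dfwith (admm_point (x k.+1) (x k) i) i y)
          (lam k))%E) /\
    lam k.+1 = lam k - gamma *: residual (x k.+1).

Definition tail_sum x (i : 'I_N.-1) : 'cV[R]_p :=
  \sum_(j < N | (i < j)%N) A j *m x j.

End ADMM.

Definition admm_sqnorm {R : realType} {N p : nat} (gamma : R)
    (u : ('I_N.-1 -> 'cV[R]_p) * 'cV[R]_p) : R :=
  gamma * \sum_(i < N.-1) enorm (u.1 i) ^+ 2
  + (2 * gamma)^-1 * enorm u.2 ^+ 2.

Definition admm_norm {R : realType} {N p : nat} (gamma : R)
    (u : ('I_N.-1 -> 'cV[R]_p) * 'cV[R]_p) : R :=
  Num.sqrt (admm_sqnorm gamma u).

(* In the rank-deficient case, "without loss of generality the first r rows are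
   linearly independent" is rendered by a permutation [s] of the rows of [A].
   The constant depends on the choice of independent rows, so this is a
   predicate: [is_kappa A kappa] holds for the constant given by any choice. *)
Definition is_kappa {R : realType} p m (A : 'M[R]_(p, m)) (kappa : R) : Prop :=
  if \rank A == p then kappa = (lambda_min (A *m A^T))^-1
  else exists (s : 'S_p) (Ar : 'M[R]_(\rank A, m))
              (B : 'M[R]_(p - \rank A, \rank A)),
    let G := 1%:M + B^T *m B in
    let E := G *m Ar in
    [/\ \rank Ar = \rank A,
        row_perm s A =
          castmx (subnKC (rank_leq_row A), erefl m) (col_mx 1%:M B *m Ar) &
        kappa = (lambda_min (E *m E^T))^-1 * lambda_max G].

(* The quotients are taken in the extended reals, where [r%:E / 0 = +oo] for
   [0 < r]: a block with [A i = 0] imposes no restriction. *)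
Section Constants.
Context {R : realType} {N p : nat} {n : 'I_N -> nat}.
Variables (hN : (3 <= N)%N) (A : forall i, 'M[R]_(p, n i)).
Variables (sigma L : 'I_N -> R) (gamma kappa : R).

Let lmax (i : 'I_N) : R := lambda_max ((A i)^T *m A i).

(* (2 N - i) (i - 1) for the block numbered i in the text *)
Let weight (i : 'I_N) : R := (2 * N%:R - i.+1%:R) * (i.+1%:R - 1).

Definition gamma_bound : \bar R :=
  let l := last_block hN in
  mine
    (\big[mine/+oo]_(i < N | (0 < i)%N && (i.+1 < N)%N)
       ((4 * sigma i)%:E / (3 * weight i * lmax i)%:E))%E
    ((4 * sigma l)%:E /
     ((3 * N%:R ^+ 2 - 3 * N%:R - 2) * lmax l)%:E)%E.

Definition delta3 : \bar R :=
  (\big[mine/+oo]_(i < N | (0 < i)%N && (i.+1 < N)%N)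
     ((4 * sigma i * gamma - 3 * gamma ^+ 2 * weight i * lmax i)%R%:E /
      (2 * gamma ^+ 2 * weight i * lmax i + 4 * kappa * L i ^+ 2)%R%:E))%E.

Definition delta4 : \bar R :=
  (\big[mine/+oo]_(i < N | (i.+1 < N)%N) (1 / (4 * kappa * lmax i)%:E))%E.

Definition delta5 : \bar R :=
  let l := last_block hN in
  ((4 * sigma l * gamma
    - (3 * N%:R ^+ 2 - 3 * N%:R - 2) * gamma ^+ 2 * lmax l)%R%:E /
   (2 * gamma ^+ 2 * N%:R * (N%:R - 1) * lmax l
    + 4 * kappa * L l ^+ 2)%R%:E)%E.

Definition delta6 : \bar R :=
  let h := first_block hN in
  mine
    ((gamma ^+ 2)%:E /
     (4 * kappa * gamma ^+ 2 * (N%:R - 1) * lmax h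
      + 4 * kappa * L h ^+ 2 * (lambda_min ((A h)^T *m A h))^-1)%R%:E)%E
    (mine delta3 (mine delta4 delta5)).

End Constants.

(* Main.v *)
Require Import Defs.
From HB Require Import structures.
From mathcomp Require Import all_boot all_order all_algebra.
From mathcomp Require Import all_classical all_reals all_analysis.
From mathcomp Require Import perm zify ring lra.

Set Implicit Arguments.
Unset Strict Implicit.
Unset Printing Implicit Defensive.

Import Order.TTheory GRing.Theory Num.Theory.
Import numFieldNormedType.Exports.

Local Open Scope classical_set_scope.
Local Open Scope ring_scope.

(* With errors e_i of the new iterate, write T_m = sum_{j >= m} A_j e_j, S_m for the
   same tail at the old iterate, d_i = S_{i+1} - T_{i+1}, and mu for the new
   multiplier error. The optimality conditions of the block updates say that the
   gradient of f_i at the new point minus that at the optimum is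
   A_i^T (mu - gamma d_i); pairing with e_i and summing by parts yields an exact
   formula for the decrease of the Lyapunov function. Strong convexity pays for
   sum |T_m|^2 (Cauchy-Schwarz, whence the weights (2N - i)(i - 1)), a quarter of
   each |d_i|^2 is set aside, and since mu is in the range of A,
   |mu|^2 <= kappa |A^T mu|^2 is controlled by L_i^2 |e_i|^2 and |d_i|^2. What
   remains is a quadratic form in (T_1, T_2, d_1), blocks being numbered from 1,
   whose nonnegativity is ensured by the first term of delta_6. *)

(** * Euclidean inner product and extreme eigenvalues of symmetric matrices *)

Section EuclideanTheory.
Context {R : realType}.

Lemma dotvE n (u v : 'cV[R]_n) : dotv u v = \sum_i u i 0 * v i 0.
Proof. by rewrite /dotv mxE; apply: eq_bigr => i _; rewrite mxE. Qed.

Lemma dotvC n (u v : 'cV[R]_n) : dotv u v = dotv v u.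
Proof. by rewrite !dotvE; apply: eq_bigr => i _; rewrite mulrC. Qed.

Lemma dotvDl n (u v w : 'cV[R]_n) : dotv (u + v) w = dotv u w + dotv v w.
Proof. by rewrite /dotv linearD mulmxDl mxE. Qed.

Lemma dotvZl n a (u v : 'cV[R]_n) : dotv (a *: u) v = a * dotv u v.
Proof. by rewrite /dotv linearZ -scalemxAl mxE. Qed.

Lemma dotvNl n (u v : 'cV[R]_n) : dotv (- u) v = - dotv u v.
Proof. by rewrite /dotv linearN mulNmx mxE. Qed.

Lemma dotvDr n (u v w : 'cV[R]_n) : dotv u (v + w) = dotv u v + dotv u w.
Proof. by rewrite dotvC dotvDl !(dotvC u). Qed.

Lemma dotvZr n a (u v : 'cV[R]_n) : dotv u (a *: v) = a * dotv u v.
Proof. by rewrite dotvC dotvZl dotvC. Qed.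

Lemma dotvNr n (u v : 'cV[R]_n) : dotv u (- v) = - dotv u v.
Proof. by rewrite dotvC dotvNl dotvC. Qed.

Lemma dotv0l n (u : 'cV[R]_n) : dotv 0 u = 0.
Proof. by rewrite /dotv linear0 mul0mx mxE. Qed.

Lemma dotv0r n (u : 'cV[R]_n) : dotv u 0 = 0.
Proof. by rewrite dotvC dotv0l. Qed.

Lemma dotv_suml n (I : finType) (P : pred I) (F : I -> 'cV[R]_n) u :
  dotv (\sum_(i | P i) F i) u = \sum_(i | P i) dotv (F i) u.
Proof.
by apply: (big_morph (fun v => dotv v u)) => [v w|]; rewrite ?dotvDl ?dotv0l.
Qed.

Lemma dotv_delta n (u : 'cV[R]_n) j : dotv u (delta_mx j 0) = u j 0.
Proof.
rewrite dotvE (bigD1 j) //= mxE !eqxx mulr1 big1 ?addr0 // => i ij.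
by rewrite mxE (negPf ij) mulr0.
Qed.

Lemma dotv_mulr m n (M : 'M[R]_(m, n)) u v :
  dotv u (M *m v) = dotv (M^T *m u) v.
Proof. by rewrite /dotv trmx_mul trmxK mulmxA. Qed.

Lemma dotv_ge0 n (u : 'cV[R]_n) : 0 <= dotv u u.
Proof. by rewrite dotvE; apply: sumr_ge0 => i _; rewrite -expr2 sqr_ge0. Qed.

Lemma dotv_eq0 n (u : 'cV[R]_n) : (dotv u u == 0) = (u == 0).
Proof.
apply/idP/eqP => [|->]; last by rewrite dotv0l.
rewrite dotvE psumr_eq0 => [|i _]; last by rewrite -expr2 sqr_ge0.
move=> /allP h; apply/matrixP => i j; rewrite ord1 mxE.
by have := h i (mem_index_enum _); rewrite /= mulf_eq0 orbb => /eqP.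
Qed.

Lemma dotv_gt0 n (u : 'cV[R]_n) : (0 < dotv u u) = (u != 0).
Proof. by rewrite lt_def dotv_ge0 andbT dotv_eq0. Qed.

Lemma sqr_enorm n (u : 'cV[R]_n) : enorm u ^+ 2 = dotv u u.
Proof. by rewrite sqr_sqrtr // dotv_ge0. Qed.

Lemma enormN n (u : 'cV[R]_n) : enorm (- u) = enorm u.
Proof. by rewrite /enorm dotvNl dotvNr opprK. Qed.

Lemma dotv_le_parallelogram n (u v : 'cV[R]_n) :
  dotv (u + v) (u + v) <= 2 * (dotv u u + dotv v v).
Proof.
have := dotv_ge0 (u - v).
rewrite !(dotvDl, dotvDr, dotvNl, dotvNr) (dotvC v u); lra.
Qed.

Lemma continuous_sum_fun (T : topologicalType) (I : Type) (s : seq I)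
    (F : I -> T -> R) :
  (forall i, continuous (F i)) -> continuous (fun x => \sum_(i <- s) F i x).
Proof.
move=> hF; elim: s => [|i s IH].
  have -> : (fun x => \sum_(i <- [::]) F i x) = cst 0.
    by apply/funext => x; rewrite big_nil.
  by move=> x; exact: cvg_cst.
have -> : (fun x => \sum_(j <- i :: s) F j x) =
    (fun x => F i x + \sum_(j <- s) F j x).
  by apply/funext => x; rewrite big_cons.
by move=> x; exact: cvgD (hF i x) (IH x).
Qed.

Lemma continuous_quad_form n (B : 'M[R]_n) :
  continuous (fun u : 'rV[R]_n => dotv u^T (B *m u^T)).
Proof.
have -> : (fun u : 'rV[R]_n => dotv u^T (B *m u^T)) =
    (fun u => \sum_i \sum_j (u 0 i * B i j) * u 0 j).
  apply/funext => u; rewrite dotvE; apply: eq_bigr => i _.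
  rewrite !mxE mulr_sumr; apply: eq_bigr => j _.
  by rewrite mxE mulrA.
apply: continuous_sum_fun => i; apply: continuous_sum_fun => j u.
apply: (@continuousM _ _ (fun u : 'rV[R]_n => u 0 i * B i j) (fun u => u 0 j));
  last exact: coord_continuous.
apply: (@continuousM _ _ (fun u : 'rV[R]_n => u 0 i) (cst (B i j)));
  [exact: coord_continuous | exact: cst_continuous].
Qed.

(** Closed as a level set of a continuous form, and bounded for the sup norm because each squared
    coordinate is one term of a sum equal to 1. *)
Lemma compact_unit_sphere n : compact [set u : 'rV[R]_n | dotv u^T u^T = 1].
Proof.
apply: bounded_closed_compact.
  exists 1; split => // M M1 u /= u1.
  rewrite [leLHS]/Num.norm /= mx_normrE; apply: bigmax_le => [|[i j] _ /=].
    exact: le_trans (ltW M1).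
  rewrite ord1 (le_trans _ (ltW M1)) //.
  rewrite -(@ler_pXn2r _ 2) ?nnegrE // expr1n -[`|_| ^+ 2]normrX.
  rewrite ger0_norm ?sqr_ge0 //.
  rewrite -u1 dotvE (bigD1 j) //= !mxE -expr2 lerDl.
  by apply: sumr_ge0 => k _; rewrite -expr2 sqr_ge0.
have -> : [set u : 'rV[R]_n | dotv u^T u^T = 1] =
    (fun u : 'rV[R]_n => dotv u^T (1%:M *m u^T)) @^-1` [set x : R | x = 1].
  by apply/seteqP; split => u /=; rewrite mul1mx.
by apply: preimage_closed => [u _|];
  [exact: continuous_quad_form | exact: closed_eq].
Qed.

(* The maximum of the Rayleigh quotient exists by compactness of the sphere; at a
   maximiser the nonnegative form [m |u|^2 - <u, B u>] vanishes, hence so does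
   its gradient. *)
Lemma rayleigh_max n (B : 'M[R]_n) : (0 < n)%N -> B^T = B ->
  exists m : R, (forall u : 'cV[R]_n, dotv u (B *m u) <= m * dotv u u) /\
    exists2 u : 'cV[R]_n, u != 0 & B *m u = m *: u.
Proof.
move=> n0 Bs.
pose S := [set u : 'rV[R]_n | dotv u^T u^T = 1].
have S0 : S !=set0.
  exists (delta_mx 0 (Ordinal n0)); rewrite /S /= trmx_delta.
  by rewrite dotv_delta mxE !eqxx.
have [c cS cmax] := EVT_max_rV S0 (@compact_unit_sphere n)
  (continuous_subspaceT (@continuous_quad_form n B)).
have {}cS : dotv c^T c^T = 1 by move: cS; rewrite inE.
set m := dotv c^T (B *m c^T) in cmax.
have ub u : dotv u (B *m u) <= m * dotv u u.
  have [->|u0] := eqVneq u 0; first by rewrite !dotv0l mulr0.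
  have up : 0 < dotv u u by rewrite dotv_gt0.
  pose k := (enorm u)^-1.
  have k2 : k * k = (dotv u u)^-1 by rewrite -expr2 exprVn sqr_enorm.
  have /cmax : (k *: u)^T \in S.
    by rewrite inE /S /= trmxK dotvZl dotvZr mulrA k2 mulVf ?gt_eqF.
  by rewrite trmxK -scalemxAr dotvZl dotvZr mulrA k2 ler_pdivrMl // mulrC.
exists m; split => //; exists c^T.
  by rewrite -dotv_gt0 cS.
set v := c^T.
have [w vB] : exists w, B *m v = w + m *: v.
  by exists (B *m v - m *: v); rewrite subrK.
suff /eqP w0 : w == 0 by rewrite vB w0 add0r.
rewrite -dotv_eq0.
(* Along [v + t *: w], where [w] is the residual [B *m v - m *: v], the linear coefficient of the
   form is [-2 |w|^2]. *)
have key t : 0 <= t ^+ 2 * (m * dotv w w - dotv w (B *m w)) - 2 * t * dotv w w.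
  have := ub (v + t *: w).
  rewrite mulmxDr -scalemxAr !(dotvDl, dotvDr, dotvZl, dotvZr).
  rewrite -/v in cS; rewrite -[dotv v (B *m v)]/m cS.
  have -> : dotv v (B *m w) = dotv w (B *m v) by rewrite dotv_mulr Bs dotvC.
  rewrite vB !(dotvDr, dotvZr) (dotvC v w); lra.
set K := _ - _ in key.
have K0 : 0 <= K by rewrite subr_ge0.
have ww := dotv_ge0 w.
rewrite eq_le ww andbT leNgt; apply/negP => d0.
(* This [t] satisfies [d = t (K + 1)], so the bound becomes [- t^2 (K + 2)]; adding 1 to [K] covers
   [K = 0]. *)
have := key (dotv w w / (K + 1)); set d := dotv w w in ww d0 *.
have K1 : 0 < K + 1 by lra.
have -> : (d / (K + 1)) ^+ 2 * K - 2 * (d / (K + 1)) * d =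
    - ((d / (K + 1)) ^+ 2 * (K + 2)) by field; rewrite gt_eqF.
have : 0 < (d / (K + 1)) ^+ 2 * (K + 2).
  by rewrite mulr_gt0 ?exprn_gt0 ?divr_gt0 //; lra.
lra.
Qed.

(* Eigenvectors in [eigenvalue] are row vectors; symmetry exchanges them with
   column ones. *)
Lemma eigenvalue_symP n (B : 'M[R]_n) a : B^T = B ->
  reflect (exists2 u : 'cV[R]_n, u != 0 & B *m u = a *: u) (eigenvalue B a).
Proof.
move=> Bs; apply: (iffP eigenvalueP) => [[v vB v0]|[u u0 uB]].
  exists v^T; first by rewrite trmx_eq0.
  by rewrite -{1}Bs -trmx_mul vB linearZ.
exists u^T; last by rewrite trmx_eq0.
by rewrite -{1}Bs -trmx_mul uB linearZ.
Qed.

(** The maximum of the Rayleigh quotient is an eigenvalue, and every eigenvalue is a value of that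
    quotient, so the supremum is this maximum. *)
Lemma lambda_maxP n (B : 'M[R]_n) : (0 < n)%N -> B^T = B ->
  (forall u : 'cV[R]_n, dotv u (B *m u) <= lambda_max B * dotv u u) /\
  exists2 u : 'cV[R]_n, u != 0 & B *m u = lambda_max B *: u.
Proof.
move=> n0 Bs; have [m [ub eig]] := rayleigh_max n0 Bs.
suff -> : lambda_max B = m by [].
apply/eqP; rewrite eq_le /lambda_max; apply/andP; split.
  apply: ge_sup; first by exists m; exact/eigenvalue_symP.
  move=> a /(eigenvalue_symP _ Bs)[u u0 uB].
  by have := ub u; rewrite uB dotvZr ler_pM2r // dotv_gt0.
apply: ub_le_sup; last exact/eigenvalue_symP.
exists m => a /(eigenvalue_symP _ Bs)[u u0 uB].
by have := ub u; rewrite uB dotvZr ler_pM2r // dotv_gt0.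
Qed.

(** The eigenvalues of [- B] are the opposites of those of [B], which reduces the claim to
    [lambda_maxP]. *)
Lemma lambda_minP n (B : 'M[R]_n) : (0 < n)%N -> B^T = B ->
  (forall u : 'cV[R]_n, lambda_min B * dotv u u <= dotv u (B *m u)) /\
  exists2 u : 'cV[R]_n, u != 0 & B *m u = lambda_min B *: u.
Proof.
move=> n0 Bs.
have NBs : (- B)^T = - B by rewrite linearN /= Bs.
suff -> : lambda_min B = - lambda_max (- B).
  have [ub [v v0 vB]] := lambda_maxP n0 NBs; split => [u|].
    have := ub u; rewrite mulNmx dotvNr; lra.
  by exists v => //; rewrite scaleNr -vB mulNmx opprK.
rewrite /lambda_min /inf /lambda_max; congr (- sup _).
apply/seteqP; split => [_ [a aB <-]|a].
  have [u u0 uB] := eigenvalue_symP a Bs aB.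
  apply/(eigenvalue_symP _ NBs); exists u => //.
  by rewrite mulNmx uB scaleNr.
move=> /(eigenvalue_symP _ NBs)[u u0 uB]; exists (- a); last exact: opprK.
apply/(eigenvalue_symP _ Bs); exists u => //.
by rewrite scaleNr -uB mulNmx opprK.
Qed.

Lemma gram_sym m n (M : 'M[R]_(m, n)) : (M^T *m M)^T = M^T *m M.
Proof. by rewrite trmx_mul trmxK. Qed.

Lemma dotv_gram m n (M : 'M[R]_(m, n)) u :
  dotv u (M^T *m M *m u) = dotv (M *m u) (M *m u).
Proof. by rewrite -mulmxA dotv_mulr trmxK. Qed.

Lemma dotv_mulmx_le m n (M : 'M[R]_(m, n)) u : (0 < n)%N ->
  dotv (M *m u) (M *m u) <= lambda_max (M^T *m M) * dotv u u.
Proof.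
by move=> n0; rewrite -dotv_gram; exact: (lambda_maxP n0 (gram_sym M)).1.
Qed.

Lemma dotv_mulmx_ge m n (M : 'M[R]_(m, n)) u : (0 < n)%N ->
  lambda_min (M^T *m M) * dotv u u <= dotv (M *m u) (M *m u).
Proof.
by move=> n0; rewrite -dotv_gram; exact: (lambda_minP n0 (gram_sym M)).1.
Qed.

Lemma lambda_max_gram_ge0 m n (M : 'M[R]_(m, n)) : (0 < n)%N ->
  0 <= lambda_max (M^T *m M).
Proof.
move=> n0; have := dotv_mulmx_le M (delta_mx (Ordinal n0) 0) n0.
by rewrite dotv_delta mxE !eqxx mulr1; apply: le_trans; exact: dotv_ge0.
Qed.

Lemma lambda_min_gram_gt0 m n (M : 'M[R]_(m, n)) : (0 < n)%N ->
  (forall u : 'cV_n, M *m u = 0 -> u = 0) -> 0 < lambda_min (M^T *m M).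
Proof.
move=> n0 inj; have [_ [u u0 uM]] := lambda_minP n0 (gram_sym M).
have : dotv u (M^T *m M *m u) = lambda_min (M^T *m M) * dotv u u.
  by rewrite uM dotvZr.
rewrite dotv_gram => h.
have : 0 < dotv (M *m u) (M *m u).
  by rewrite dotv_gt0; apply: contra u0 => /eqP/inj/eqP.
by rewrite h pmulr_lgt0 ?dotv_gt0.
Qed.

Lemma lambda_max_gram_gt0 m n (M : 'M[R]_(m, n)) : (0 < n)%N ->
  (forall u : 'cV_n, M *m u = 0 -> u = 0) -> 0 < lambda_max (M^T *m M).
Proof.
move=> n0 inj; set u : 'cV[R]_n := delta_mx (Ordinal n0) 0.
have u1 : dotv u u = 1 by rewrite dotv_delta mxE !eqxx.
have u0 : u != 0 by rewrite -dotv_gt0 u1.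
have := dotv_mulmx_le M u n0; rewrite u1 mulr1; apply: lt_le_trans.
by rewrite dotv_gt0; apply: contra u0 => /eqP/inj/eqP.
Qed.

End EuclideanTheory.

(** * Subgradients, gradients and minimality conditions *)

Section ConvexTheory.
Context {R : realType}.

(** The difference quotient is at most [c] for [h < 0] and at least [c] for [h > 0]; the two
    one-sided limits squeeze the derivative. *)
Lemma derive_eq_slope n (f : 'cV[R]_n -> R) (a v : 'cV[R]_n) (c : R) :
  derivable f a v -> (forall h : R, h * c <= f (h *: v + a) - f a) ->
  'D_v f a = c.
Proof.
pose q h : R := h^-1 *: ((f \o shift a) (h *: v) - f a).
move=> fd slope; apply/eqP; rewrite eq_le; apply/andP; split.
  rewrite /derive (cvg_at_leftE q) //; apply: limr_le.
    rewrite -(cvg_at_leftE q) //; apply: cvg_trans fd; apply: cvg_app.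
    by move=> B [r r0 Br]; exists r => // h hr h0; apply: Br => //; exact: ltr0_neq0.
  near=> h.
  have h0 : h < 0 by near: h; exists 1 => /=.
  rewrite -[q h]/(h^-1 * _) ler_ndivrMl //; exact: slope.
rewrite /derive (cvg_at_rightE q) //; apply: limr_ge.
  rewrite -(cvg_at_rightE q) //; apply: cvg_trans fd; apply: cvg_app.
  by move=> B [r r0 Br]; exists r => // h hr h0; apply: Br => //; exact: lt0r_neq0.
near=> h.
have h0 : 0 < h by near: h; exists 1 => /=.
rewrite -[q h]/(h^-1 * _) ler_pdivlMl //; exact: slope.
Unshelve. all: by end_near.
Qed.

(** Along the basis vector [j] the subgradient inequality supplies the slope [g j 0]. This lets the
    Lipschitz bound on gradients apply to the vectors produced by the optimality conditions. *)
Lemma subgradient_gradient n (f : 'cV[R]_n -> R) (x g : 'cV[R]_n) :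
  differentiable f x -> (forall y, f x + dotv g (y - x) <= f y) ->
  gradient f x = g.
Proof.
move=> fd sub; apply/matrixP => j k; rewrite ord1 mxE; apply: derive_eq_slope.
  exact: diff_derivable.
move=> h; have := sub (h *: delta_mx j 0 + x).
rewrite addrK dotvZr dotv_delta; lra.
Qed.

Lemma convex_function_segment n (f : 'cV[R]_n -> R) (x y : 'cV[R]_n) (t : R) :
  convex_function setT f -> 0 <= t <= 1 ->
  f (x + t *: (y - x)) <= f x + t * (f y - f x).
Proof.
move=> cf /andP[t0 t1].
have := cf (Itv01 t0 t1) y x (in_setT _) (in_setT _).
rewrite convRE /= {1}/conv /= /unstable.onem.
have -> : t *: y + (1 - t) *: x = x + t *: (y - x).
  by rewrite scalerBl scale1r scalerBr addrCA.
by move/le_trans; apply; lra.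
Qed.

(* Dividing the minimality inequality at [x + t (y - x)] by [t] and letting [t]
   tend to [0] discards the quadratic term. *)
Lemma subgradient_quadratic_min n p (f : 'cV[R]_n -> R) (M : 'M[R]_(p, n))
    (c l : 'cV[R]_p) (gamma : R) (x : 'cV[R]_n) :
  convex_function setT f -> 0 <= gamma ->
  let q y := - dotv l (c + M *m y) + gamma / 2 * enorm (c + M *m y) ^+ 2 in
  (forall y, f x + q x <= f y + q y) ->
  forall y, f x + dotv (M^T *m (l - gamma *: (c + M *m x))) (y - x) <= f y.
Proof.
move=> cf gamma0 q qmin y.
have [r rE] : exists r, r = c + M *m x by exists (c + M *m x).
have [d dE] : exists d, d = M *m (y - x) by exists (M *m (y - x)).
rewrite -dotv_mulr -rE -dE.
have key t : 0 < t <= 1 ->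
    dotv (l - gamma *: r) d - (f y - f x) <= t * (gamma / 2 * dotv d d).
  move=> /andP[t0 t1].
  have := qmin (x + t *: (y - x)).
  have := @convex_function_segment n f x y t cf; rewrite (ltW t0) t1 => /(_ isT).
  rewrite /q !sqr_enorm.
  have -> : c + M *m (x + t *: (y - x)) = r + t *: d.
    by rewrite mulmxDr -scalemxAr addrA rE dE.
  rewrite -rE !(dotvDl, dotvDr, dotvNl, dotvNr, dotvZl, dotvZr) (dotvC d r).
  move=> h1 h2; rewrite -(ler_pM2l t0); lra.
rewrite leNgt; apply/negP => lt0.
set s := dotv (l - gamma *: r) d - (f y - f x) in key.
have s0 : 0 < s by rewrite /s; lra.
set C := gamma / 2 * dotv d d in key.
have C0 : 0 <= C by rewrite mulr_ge0 ?dotv_ge0 //; lra.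
have den0 : 0 < s + C by lra.
(* This [t] lies in [(0, 1/2]] and makes [t C < s], contradicting [key]. *)
have := key (s / (2 * (s + C))); rewrite divr_gt0 ?mulr_gt0 //=.
rewrite ler_pdivrMr ?mulr_gt0 // mul1r.
have -> : s <= 2 * (s + C) by lra.
move=> /(_ isT); rewrite leNgt => /negP; apply.
rewrite mulrAC ltr_pdivrMr ?mulr_gt0 // ltr_pM2l //; lra.
Qed.

Lemma restricted_fin_num n (F : 'cV[R]_n -> R) (X : set 'cV[R]_n) x :
  restricted F X x \is a fin_num -> X x /\ restricted F X x = (F x)%:E.
Proof.
rewrite /restricted /indic_infty; case: ifPn => // /set_mem Xx _.
by split=> //; rewrite adde0.
Qed.

End ConvexTheory.

(** * Quadratic estimates for tails and cross terms *)

Section EnergyEstimates.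
Context {R : realType}.

(** Cauchy-Schwarz against the constant vector: the squares [(c F_i - s)^2] add up to
    [c (c q - s^2)]. *)
Lemma sqr_sum_le (I : finType) (P : pred I) (F : I -> R) :
  (\sum_(i | P i) F i) ^+ 2 <= #|P|%:R * \sum_(i | P i) F i ^+ 2.
Proof.
set s := \sum_(i | P i) F i; set q := \sum_(i | P i) F i ^+ 2; set c := #|P|%:R.
have [/eqP|c0] := posnP #|P|.
  move=> /eqP/card0_eq P0; rewrite /s big_pred0 // expr0n /= mulr_ge0 ?ler0n //.
  by apply: sumr_ge0 => i _; exact: sqr_ge0.
have : 0 <= \sum_(i | P i) (c * F i - s) ^+ 2.
  by apply: sumr_ge0 => i _; exact: sqr_ge0.
have -> : \sum_(i | P i) (c * F i - s) ^+ 2 =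
    c ^+ 2 * q + ((- 2 * c * s) * s + s ^+ 2 * c).
  rewrite (eq_bigr (fun i => c ^+ 2 * F i ^+ 2 + (- 2 * c * s * F i + s ^+ 2)));
    last by move=> i _; ring.
  by rewrite !big_split /= -!mulr_sumr sumr_const -[s *+ _]mulr_natr mulrA -expr2.
have -> : c ^+ 2 * q + (- 2 * c * s * s + s ^+ 2 * c) = c * (c * q - s ^+ 2).
  by ring.
by rewrite pmulr_rge0 ?ltr0n // subr_ge0.
Qed.

Lemma dotv_sum_le p (I : finType) (P : pred I) (a : I -> 'cV[R]_p) :
  dotv (\sum_(i | P i) a i) (\sum_(i | P i) a i) <=
  #|P|%:R * \sum_(i | P i) dotv (a i) (a i).
Proof.
under [in leRHS]eq_bigr do rewrite dotvE.
rewrite dotvE exchange_big mulr_sumr; apply: ler_sum => c _ /=.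
rewrite !summxE -expr2.
by under [in leRHS]eq_bigr do rewrite -expr2; exact: sqr_sum_le.
Qed.

(** Half of it is the sum of [N - m - 1] over [m < i], the total length of the tails that contain
    block [i]. *)
Definition block_weight N (i : 'I_N) : R :=
  (2 * N%:R - i.+1%:R) * (i.+1%:R - 1).

Lemma block_weight_ge0 N (i : 'I_N) : 0 <= block_weight i.
Proof.
rewrite mulr_ge0 // subr_ge0 ?ler1n //.
have : i.+1%:R <= N%:R :> R by rewrite ler_nat.
have : 0 <= N%:R :> R by exact: ler0n.
lra.
Qed.

(** Each tail costs its length times its sum of squares; after exchanging the sums, block [j]
    collects the lengths of all tails containing it. *)
Lemma sum_tail_le N p (a : 'I_N -> 'cV[R]_p) :
  \sum_(i < N.-1) dotv (\sum_(j < N | (i < j)%N) a j)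
                       (\sum_(j < N | (i < j)%N) a j) <=
  \sum_(j < N) block_weight j / 2 * dotv (a j) (a j).
Proof.
have card_tail (i : 'I_N.-1) : #|[pred j : 'I_N | (i < j)%N]| = (N - i.+1)%N.
  rewrite -sum1_card -(big_mkord (fun j => i < j)%N (fun=> 1%N)).
  have iN : (i.+1 <= N)%N by move: (ltn_ord i); lia.
  rewrite (big_cat_nat (n := i.+1)) //= big1_seq ?add0n; last first.
    by move=> j /andP[ij]; rewrite mem_index_iota; lia.
  rewrite big_nat_cond (eq_bigl (fun j => (i.+1 <= j < N)%N)); last by move=> j; lia.
  by rewrite -big_nat sum_nat_const_nat muln1.
apply: (@le_trans _ _ (\sum_(i < N.-1)
    ((N - i.+1)%:R * \sum_(j < N | (i < j)%N) dotv (a j) (a j)))).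
  by apply: ler_sum => i _; rewrite -card_tail; exact: dotv_sum_le.
under eq_bigr do rewrite mulr_sumr.
rewrite (exchange_big_dep predT) //=; apply: ler_sum => j _.
rewrite -mulr_suml ler_wpM2r ?dotv_ge0 // /block_weight.
rewrite -(big_mkord (fun i => i < j)%N (fun i => (N - i.+1)%:R : R)).
have jN := ltn_ord j.
have jN1 : (j <= N.-1)%N by lia.
rewrite (big_cat_nat (n := j)) //= [X in _ + X]big1_seq ?addr0; last first.
  by move=> i /andP[ij]; rewrite mem_index_iota; lia.
rewrite big_nat_cond (eq_bigl (fun i => (0 <= i < j)%N)); last by move=> i; lia.
rewrite -big_nat le_eqVlt; apply/orP; left; apply/eqP.
move: (nat_of_ord j) (ltnW jN); elim=> [|m IH] mN.
  by rewrite big_nil subrr mulr0 mul0r.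
rewrite big_nat_recr //= IH ?(ltnW mN) // natrB // -![_.+1%:R]natr1.
by field.
Qed.

(** Applied to [T_1], [d_1], [T_2] (blocks numbered from 1). The coefficient 5/6 is 3/2 minus the
    2/3 kept for the next cross term; [beta] pays for [|A_1 e_1|^2]. *)
Lemma first_block_form p (alpha beta : R) (r d t : 'cV[R]_p) :
  0 <= alpha -> 0 <= beta -> 2 * alpha + beta <= 1 / 4 ->
  alpha * dotv d d + beta * dotv (r - t) (r - t) <=
  1 / 2 * dotv r r + (dotv d d + dotv (r + t) d) + 5 / 6 * dotv t t.
Proof.
move=> a0 b0 ab; rewrite !dotvE !mulr_sumr -!big_split /=.
apply: ler_sum => i _; rewrite !mxE.
move: (r i 0) (d i 0) (t i 0) => x y z.
(* The form is affine in [(alpha, beta)]: it suffices to check the vertices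
   [(1/8, 0)] and [(0, 1/4)]. *)
have q1 : 0 <= 1 / 2 * x ^+ 2 + 7 / 8 * y ^+ 2 + (x + z) * y + 5 / 6 * z ^+ 2.
  have := sqr_ge0 (y + 4 / 7 * (x + z)); have := sqr_ge0 (x - 4 / 3 * z).
  have := sqr_ge0 z; lra.
have q2 : 0 <= 1 / 4 * x ^+ 2 + y ^+ 2 + (x + z) * y + 7 / 12 * z ^+ 2
    + 1 / 2 * x * z.
  have := sqr_ge0 (y + (x + z) / 2); have := sqr_ge0 z; lra.
(* The weights [1 - 4 beta] and [4 beta] give the point with this [beta] on the edge joining the
   vertices; [sl] is the slack of [alpha] below that edge. *)
have b1 : 0 <= 1 - 4 * beta by lra.
have b4 : 0 <= 4 * beta by lra.
have sl : 0 <= 1 / 8 - beta / 2 - alpha by lra.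
have := mulr_ge0 b1 q1; have := mulr_ge0 b4 q2.
have := mulr_ge0 sl (sqr_ge0 y); lra.
Qed.

(** Completing the square in the remaining [3/4 |d|^2] costs [1/3 |v + w|^2], at most
    [2/3 (|v|^2 + |w|^2)]. *)
Lemma cross_form p (alpha : R) (v w d : 'cV[R]_p) : alpha <= 1 / 4 ->
  alpha * dotv d d <=
  dotv d d + dotv (v + w) d + 2 / 3 * (dotv v v + dotv w w).
Proof.
move=> a; rewrite !dotvE mulr_sumr -!big_split /= mulr_sumr -big_split /=.
apply: ler_sum => i _; rewrite !mxE.
move: (v i 0) (w i 0) (d i 0) => x y z.
have := sqr_ge0 (x - y); have := sqr_ge0 (3 * z + 2 * (x + y)).
have := mulr_ge0 (_ : 0 <= 1 / 4 - alpha) (sqr_ge0 z); lra.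
Qed.

(** Induction on the number of cross terms. The final [- 2 / 3] reserves what the next cross term
    takes from the last tail: [T 1] is charged 5/6 + 2/3 = 3/2, and a later tail at most 2/3 +
    2/3. *)
Lemma cross_terms_le p K (T d : nat -> 'cV[R]_p) (alpha : nat -> R) (beta : R) :
  (forall i, (i <= K)%N -> alpha i <= 1 / 4) ->
  0 <= alpha 0%N -> 0 <= beta -> 2 * alpha 0%N + beta <= 1 / 4 ->
  \sum_(i < K.+1) alpha i * dotv (d i) (d i)
    + beta * dotv (T 0%N - T 1%N) (T 0%N - T 1%N) <=
  1 / 2 * dotv (T 0%N) (T 0%N)
  + \sum_(i < K.+1) (dotv (d i) (d i) + dotv (T i + T i.+1) (d i))
  + 3 / 2 * \sum_(i < K.+1) dotv (T i.+1) (T i.+1)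
  - 2 / 3 * dotv (T K.+1) (T K.+1).
Proof.
move=> alphaK alpha0 beta0 ab; elim: K alphaK => [|K IH] alphaK.
  have := first_block_form (T 0%N) (d 0%N) (T 1%N) alpha0 beta0 ab.
  rewrite !big_ord1 /=; lra.
have {}IH := IH (fun i iK => alphaK i (leqW iK)).
have := cross_form (T K.+1) (T K.+2) (d K.+1) (alphaK _ (leqnn _)).
have := dotv_ge0 (T K.+2).
rewrite !(big_ord_recr K.+1) /=.
move: IH; set s1 := \sum_(i < _) _; set s2 := \sum_(i < _) _; set s3 := \sum_(i < _) _.
lra.
Qed.

End EnergyEstimates.

(** * The constant [kappa] and vectors in the range of a matrix *)

Section RangeConstant.
Context {R : realType}.

(** With [u = M^T v], expanding [|M u - l v|^2 >= 0] and using [|M u|^2 <= l |u|^2] gives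
    [l |u|^2 <= l^2 |v|^2]. If [l = 0] then [M u = 0], so [|u|^2 = <M u, v> = 0]. *)
Lemma dotv_trmulmx_le m n (M : 'M[R]_(m, n)) v : (0 < n)%N ->
  dotv (M^T *m v) (M^T *m v) <= lambda_max (M^T *m M) * dotv v v.
Proof.
move=> n0; set l := lambda_max _; set u := M^T *m v.
have l0 : 0 <= l by exact: lambda_max_gram_ge0.
have Mu : dotv (M *m u) (M *m u) <= l * dotv u u by exact: dotv_mulmx_le.
have uu : dotv (M *m u) v = dotv u u by rewrite dotvC dotv_mulr.
have := dotv_ge0 (M *m u - l *: v).
rewrite !(dotvDl, dotvDr, dotvNl, dotvNr, dotvZl, dotvZr) (dotvC v) uu => sq.
move: l0; rewrite le_eqVlt => /orP[/eqP l0|l0]; last by rewrite -(ler_pM2l l0); lra.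
rewrite -l0 mul0r in Mu *.
have /eqP Mu0 : M *m u == 0 by rewrite -dotv_eq0 eq_le Mu dotv_ge0.
by rewrite -uu Mu0 dotv0l mul0r.
Qed.

Lemma lambda_min_outer_gt0 m p (M : 'M[R]_(p, m)) : (0 < p)%N -> row_free M ->
  0 < lambda_min (M *m M^T).
Proof.
move=> p0 Mfree; rewrite -[X in X *m _]trmxK; apply: lambda_min_gram_gt0 => // u.
move/(congr1 trmx); rewrite trmx_mul trmxK trmx0 => /eqP.
by rewrite mulmx_free_eq0 // trmx_eq0 => /eqP.
Qed.

Lemma dotv_le_outer m p (M : 'M[R]_(p, m)) v : (0 < p)%N -> row_free M ->
  dotv v v <= (lambda_min (M *m M^T))^-1 * dotv (M^T *m v) (M^T *m v).
Proof.
move=> p0 Mfree; rewrite ler_pdivlMl; last exact: lambda_min_outer_gt0.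
by have := dotv_mulmx_ge M^T v p0; rewrite trmxK.
Qed.

Lemma dotv_row_perm m p (s : 'S_p) (M : 'M[R]_(p, m)) (v : 'cV[R]_p) :
  dotv (row_perm s v) (row_perm s v) = dotv v v /\
  (row_perm s M)^T *m row_perm s v = M^T *m v.
Proof.
split.
  rewrite !dotvE [RHS](reindex_inj (@perm_inj _ s)) /=.
  by apply: eq_bigr => i _; rewrite !mxE.
apply/matrixP => i j; rewrite !mxE [RHS](reindex_inj (@perm_inj _ s)) /=.
by apply: eq_bigr => k _; rewrite !mxE.
Qed.

Lemma stacked_rows_dotv m p q r (e : (r + q = p)%N) (Ar : 'M[R]_(r, m))
    (B : 'M[R]_(q, r)) (w : 'cV[R]_m) :
  let P := castmx (e, erefl m) (col_mx 1%:M B *m Ar) in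
  let G := 1%:M + B^T *m B in
  dotv (P *m w) (P *m w) = dotv (Ar *m w) (G *m (Ar *m w)) /\
  P^T *m (P *m w) = (G *m Ar)^T *m (Ar *m w).
Proof.
(* Destructing the equation on [p] turns the cast into the identity. *)
case: p / e; rewrite castmx_id /=.
set C := col_mx 1%:M B; set G := 1%:M + B^T *m B.
have CC : C^T *m C = G by rewrite tr_col_mx mul_row_col trmx1 mul1mx.
have Gs : G^T = G by rewrite -CC gram_sym.
split; last by rewrite !trmx_mul Gs -CC !mulmxA.
by rewrite -!mulmxA -dotv_gram CC.
Qed.

(** In the deficient case put [v = M w] and [mu = Ar w], up to the row permutation. Then
    [|v|^2 = <mu, G mu>] is at most [lambda_max G] times [|mu|^2], and [E^T mu = M^T v] with [E] of
    full row rank bounds [|mu|^2]. *)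
Lemma is_kappa_bound m p (M : 'M[R]_(p, m)) kappa :
  (0 < \rank M)%N -> is_kappa M kappa ->
  0 < kappa /\
  forall v : 'cV[R]_p, (\rank M <> p -> exists w, v = M *m w) ->
    dotv v v <= kappa * dotv (M^T *m v) (M^T *m v).
Proof.
rewrite /is_kappa => r0; case: ifPn => [/eqP rp ->|/eqP rp].
  have Mfree : row_free M by rewrite /row_free rp.
  have p0 : (0 < p)%N by rewrite -rp.
  split=> [|v _]; last exact: dotv_le_outer.
  by rewrite invr_gt0; exact: lambda_min_outer_gt0.
move=> [s [Ar [B]]]; set G := 1%:M + _; set E := G *m Ar => -[rAr sM ->].
have Gs : G^T = G by rewrite linearD /= trmx1 gram_sym.
have GE u : dotv u (G *m u) = dotv u u + dotv (B *m u) (B *m u).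
  by rewrite mulmxDl mul1mx dotvDr dotv_gram.
have [Gle [u0 u0n u0G]] := lambda_maxP r0 Gs.
have G1 : 0 < lambda_max G.
  have := GE u0; rewrite u0G dotvZr => h.
  have : 0 < dotv u0 u0 by rewrite dotv_gt0.
  move=> u0p; rewrite -(pmulr_lgt0 _ u0p) h.
  by rewrite ltr_pwDl // dotv_ge0.
(* The rows of [Ar] are independent, and [G] is injective because [<u, G u> >= |u|^2]. *)
have Efree : row_free E.
  rewrite -kermx_eq0; apply/rowV0P => v /sub_kermxP.
  rewrite mulmxA => /eqP; rewrite mulmx_free_eq0; last by rewrite /row_free rAr.
  move/eqP/(congr1 trmx); rewrite trmx_mul Gs trmx0 => Gv.
  have := GE v^T; rewrite Gv dotv0r => h.
  have := dotv_ge0 (B *m v^T); have := dotv_ge0 v^T.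
  move=> v1 v2; have : dotv v^T v^T == 0 by rewrite eq_le v1 andbT; lra.
  by rewrite dotv_eq0 trmx_eq0 => /eqP.
split=> [|v /(_ rp)[w ->]].
  by rewrite mulr_gt0 // invr_gt0; exact: lambda_min_outer_gt0.
have [<- <-] := dotv_row_perm s M (M *m w).
have -> : row_perm s (M *m w) = row_perm s M *m w by rewrite !row_permE mulmxA.
rewrite sM.
have [-> ->] := stacked_rows_dotv (subnKC (rank_leq_row M)) Ar B w.
rewrite -/G -/E; set mu := Ar *m w.
apply: le_trans (Gle mu) _; rewrite -mulrA [leRHS]mulrCA ler_pM2l //.
exact: dotv_le_outer.
Qed.

End RangeConstant.

(** * Tails of the block sum *)

Section BlockTails.
Context {R : realType} {N p : nat} {n : 'I_N -> nat}.
Variable A : forall i, 'M[R]_(p, n i).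

(** A natural number as index makes the full sum ([m = 0]) and the empty tail ([m = N]) instances of
    the same family. *)
Definition tail_from (e : forall i, 'cV[R]_(n i)) (m : nat) : 'cV[R]_p :=
  \sum_(j < N | (m <= j)%N) A j *m e j.

Lemma tail_fromS e (i : 'I_N) : A i *m e i = tail_from e i - tail_from e i.+1.
Proof.
rewrite /tail_from (bigD1 i) //=.
rewrite [X in _ + X - _](eq_bigl (fun j : 'I_N => (i < j)%N)) ?addrK //.
by move=> j; rewrite ltn_neqAle andbC eq_sym.
Qed.

Lemma tail_from_out e : tail_from e N = 0.
Proof. by apply: big_pred0 => j; rewrite leqNgt ltn_ord. Qed.

Lemma tail_fromB e e' m :
  tail_from (fun i => e i - e' i) m = tail_from e m - tail_from e' m.
Proof. by rewrite -sumrB; apply: eq_bigr => i _; rewrite mulmxBr. Qed.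

End BlockTails.

(** * Decrease of the Lyapunov function in one iteration, with [N = K.+2] *)

Section OneStep.
Context {R : realType} {K p : nat} {n : 'I_K.+2 -> nat}.
Variable A : forall i, 'M[R]_(p, n i).

(* [T m], [S m] are the new and the old sum of [A j *m e j] over [m <= j], and
   [h i] is the gradient difference of block [i]. *)
Lemma energy_identity (T S : nat -> 'cV[R]_p) (mu : 'cV[R]_p) (gamma : R)
    (e h : forall i, 'cV[R]_(n i)) :
  gamma != 0 ->
  (forall i : 'I_K.+2, A i *m e i = T i - T i.+1) ->
  T K.+2 = 0 -> S K.+2 = 0 ->
  (forall i : 'I_K.+2, h i = (A i)^T *m (mu - gamma *: (S i.+1 - T i.+1))) ->
  gamma * \sum_(i < K.+1) dotv (S i.+1) (S i.+1)
    + (2 * gamma)^-1 * dotv (mu + gamma *: T 0%N) (mu + gamma *: T 0%N) =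
  gamma * \sum_(i < K.+1) dotv (T i.+1) (T i.+1)
    + (2 * gamma)^-1 * dotv mu mu
    + \sum_i dotv (e i) (h i)
    + gamma * (1 / 2 * dotv (T 0%N) (T 0%N)
      + \sum_(i < K.+1) (dotv (S i.+1 - T i.+1) (S i.+1 - T i.+1)
         + dotv (T i + T i.+1) (S i.+1 - T i.+1))).
Proof.
move=> gamma0 AeE TN SN hE.
(* The [mu] parts telescope to [T 0]; the last block gives no [d] term since both tails after it are
   empty. *)
have -> : \sum_i dotv (e i) (h i) =
    dotv (T 0%N) mu
    - gamma * \sum_(i < K.+1) dotv (T i - T i.+1) (S i.+1 - T i.+1).
  rewrite (eq_bigr (fun i : 'I_K.+2 => dotv (T i - T i.+1) mu +
      - gamma * dotv (T i - T i.+1) (S i.+1 - T i.+1))); last first.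
    move=> i _; rewrite hE dotv_mulr trmxK AeE dotvDr dotvNr dotvZr; lra.
  rewrite big_split /= -mulr_sumr mulNr; congr (_ - gamma * _).
    rewrite -dotv_suml -(big_mkord predT (fun i => T i - T i.+1)).
    rewrite (@telescope_sumr_eq _ _ _ (fun i => - T i)) // => [|i _].
      by rewrite TN oppr0 add0r opprK.
    by rewrite opprK addrC.
  by rewrite big_ord_recr /= TN SN subrr dotv0r addr0.
(* Expand [|T_{i+1} + d_i|^2], writing [2 T_{i+1}] as [(T_i + T_{i+1}) - (T_i - T_{i+1})]. *)
have -> : \sum_(i < K.+1) dotv (S i.+1) (S i.+1) =
    \sum_(i < K.+1) dotv (T i.+1) (T i.+1)
    - \sum_(i < K.+1) dotv (T i - T i.+1) (S i.+1 - T i.+1)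
    + \sum_(i < K.+1) (dotv (S i.+1 - T i.+1) (S i.+1 - T i.+1)
         + dotv (T i + T i.+1) (S i.+1 - T i.+1)).
  rewrite -sumrN -!big_split /=; apply: eq_bigr => i _.
  rewrite !(dotvDl, dotvDr, dotvNl, dotvNr) (dotvC (S i.+1) (T i.+1)); ring.
rewrite !(dotvDl, dotvDr, dotvZl, dotvZr) (dotvC mu (T 0%N)).
by field.
Qed.

Local Notation N := (K.+2%:R : R).
Local Notation W := (@block_weight R K.+2).

(** Here [e] and [e'] are the new and old errors, and [lmax], [lmin] enter through their operator
    bounds. The conditions on [delta] are the terms of [delta6] cleared of denominators. *)
Variables (sigma L lmax : 'I_K.+2 -> R) (gamma kappa delta lmin : R).
Variables (e e' h : forall i, 'cV[R]_(n i)) (mu : 'cV[R]_p).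
Hypothesis K_gt0 : (0 < K)%N.
Hypothesis gamma_gt0 : 0 < gamma.
Hypothesis kappa_gt0 : 0 < kappa.
Hypothesis delta_gt0 : 0 < delta.
Hypothesis lmin_gt0 : 0 < lmin.
Hypothesis lmax_ge0 : forall i, 0 <= lmax i.
Hypothesis A_le : forall i u, dotv (A i *m u) (A i *m u) <= lmax i * dotv u u.
Hypothesis At_le : forall i v,
  dotv ((A i)^T *m v) ((A i)^T *m v) <= lmax i * dotv v v.
Hypothesis A0_ge : forall u,
  lmin * dotv u u <= dotv (A ord0 *m u) (A ord0 *m u).
Hypothesis hE : forall i : 'I_K.+2,
  h i = (A i)^T *m (mu - gamma *: (tail_from A e' i.+1 - tail_from A e i.+1)).
Hypothesis monotone0 : 0 <= dotv (e ord0) (h ord0).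
Hypothesis monotone : forall i : 'I_K.+2, (0 < i)%N ->
  sigma i * dotv (e i) (e i) <= dotv (e i) (h i).
Hypothesis lipschitz : forall i, dotv (h i) (h i) <= L i ^+ 2 * dotv (e i) (e i).
Hypothesis mu_le : dotv mu mu <=
  kappa * \sum_i dotv ((A i)^T *m mu) ((A i)^T *m mu).
Hypothesis delta_first :
  delta * (4 * kappa * gamma ^+ 2 * (N - 1) * lmax ord0
           + 4 * kappa * L ord0 ^+ 2 * lmin^-1) <= gamma ^+ 2.
Hypothesis delta_mid : forall i : 'I_K.+2, (0 < i)%N -> (i.+1 < K.+2)%N ->
  delta * (2 * gamma ^+ 2 * W i * lmax i + 4 * kappa * L i ^+ 2) <=
  4 * sigma i * gamma - 3 * gamma ^+ 2 * W i * lmax i.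
Hypothesis delta_max : forall i : 'I_K.+2, (i.+1 < K.+2)%N ->
  delta * (4 * kappa * lmax i) <= 1.
Hypothesis delta_last :
  delta * (2 * gamma ^+ 2 * N * (N - 1) * lmax ord_max
           + 4 * kappa * L ord_max ^+ 2) <=
  4 * sigma ord_max * gamma
  - (3 * N ^+ 2 - 3 * N - 2) * gamma ^+ 2 * lmax ord_max.

Local Notation d i := (tail_from A e' i.+1 - tail_from A e i.+1).

(** Split [A_i^T mu] as [h_i + gamma A_i^T d_i]: the Lipschitz bound controls the first part,
    [At_le] the second. The sum of the [d i] stops before the last block, where [d] vanishes. *)
Lemma multiplier_bound : dotv mu mu <=
  2 * kappa * (\sum_i L i ^+ 2 * dotv (e i) (e i)
    + gamma ^+ 2 * \sum_(i < K.+1) lmax (inord i) * dotv (d i) (d i)).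
Proof.
apply: le_trans mu_le _; rewrite -mulrA mulrCA ler_pM2l //.
have -> : \sum_(i < K.+1) lmax (inord i) * dotv (d i) (d i) =
    \sum_i lmax i * dotv (d i) (d i).
  have dN : d K.+1 = 0 by rewrite !tail_from_out subrr.
  rewrite [RHS]big_ord_recr /= dN dotv0r mulr0 addr0.
  apply: eq_bigr => i _; congr (lmax _ * _).
  by apply: val_inj; rewrite /= inordK // ltnW // ltnS.
rewrite mulr_sumr -big_split mulr_sumr; apply: ler_sum => i _ /=.
have -> : (A i)^T *m mu = h i + gamma *: ((A i)^T *m d i).
  by rewrite hE mulmxBr -scalemxAr subrK.
apply: le_trans (dotv_le_parallelogram _ _) _.
rewrite ler_pM2l // lerD // dotvZl dotvZr mulrA -expr2 ler_pM2l ?exprn_gt0 //.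
Qed.

(** Scaled by [4 gamma], this is strong convexity combined with the conditions on [delta]. The
    deduction for the last block, covered later by the 2/3 left in [cross_terms_le], produces the
    constant [3 N (N - 1) - 2]. The first block has weight 0 and only monotonicity, so its Lipschitz
    term is deferred. *)
Lemma block_bound (i : 'I_K.+2) :
  gamma * (3 / 2 + delta) * (W i / 2 * dotv (A i *m e i) (A i *m e i))
    + delta * kappa / gamma * (L i ^+ 2 * dotv (e i) (e i))
    - (if i == ord_max then
         gamma / 2 * dotv (A ord_max *m e ord_max) (A ord_max *m e ord_max) else 0)
    - (if i == ord0 then
         delta * kappa / gamma * (L ord0 ^+ 2 * dotv (e ord0) (e ord0)) else 0)
  <= dotv (e i) (h i).
Proof.
have [->|i0] := eqVneq i ord0.
  have -> : W ord0 = 0 by rewrite /block_weight subrr mulr0.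
  by rewrite mul0r mul0r mulr0 add0r subr0 subrr.
have ip : (0 < i)%N by rewrite lt0n.
apply: le_trans (monotone ip).
have ee := dotv_ge0 (e i).
have ae := A_le (e i).
have g4 : 0 < 4 * gamma by rewrite mulr_gt0.
have g2 : 0 < gamma ^+ 2 by rewrite exprn_gt0.
have kg x : 4 * gamma * (delta * kappa / gamma * x) = 4 * delta * kappa * x.
  by field; rewrite gt_eqF.
have N2 : 2 <= N by rewrite ler_nat.
have Wge : 0 <= W i by exact: block_weight_ge0.
rewrite -(ler_pM2l g4).
have [iE|iN] := eqVneq i ord_max; rewrite subr0.
  have WE : W i = N * (N - 1).
    by rewrite /block_weight iE /=; ring.
  have := delta_last; rewrite -iE => dl.
  have {}dl := ler_wpM2r ee dl.
  have c0 : 0 <= gamma ^+ 2 * (3 * N ^+ 2 - 3 * N - 2 + 2 * delta * W i).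
    rewrite mulr_ge0 ?(ltW g2) // addr_ge0 //; first by nra.
    by rewrite mulr_ge0 // ?mulr_ge0 // ltW.
  have {}ae := ler_wpM2l c0 ae.
  rewrite mulrBr mulrDr kg; move: ae dl; rewrite WE.
  move: (dotv (e i) (e i)) (dotv (A i *m e i) (A i *m e i)) => E a; lra.
have iK : (i.+1 < K.+2)%N.
  by rewrite ltn_neqAle -[i.+1 != _]/(i != ord_max :> nat) ltn_ord andbT.
have dm := ler_wpM2r ee (delta_mid ip iK).
have c0 : 0 <= gamma ^+ 2 * (3 + 2 * delta) * W i.
  by rewrite mulr_ge0 // mulr_ge0 ?(ltW g2) // addr_ge0 // mulr_ge0 // ltW.
have {}ae := ler_wpM2l c0 ae.
rewrite subr0 mulrDr kg; move: ae dm.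
move: (dotv (e i) (e i)) (dotv (A i *m e i) (A i *m e i)) => E a; lra.
Qed.

Lemma contraction_step :
  (1 + delta) *
  (gamma * \sum_(i < K.+1) dotv (tail_from A e i.+1) (tail_from A e i.+1)
   + (2 * gamma)^-1 * dotv mu mu) <=
  gamma * \sum_(i < K.+1) dotv (tail_from A e' i.+1) (tail_from A e' i.+1)
  + (2 * gamma)^-1 * dotv (mu + gamma *: tail_from A e 0)
                          (mu + gamma *: tail_from A e 0).
Proof.
have g0 : gamma != 0 by rewrite gt_eqF.
rewrite (energy_identity g0 (tail_fromS A e) (tail_from_out A e)
  (tail_from_out A e') hE).
set P := \sum_i dotv (e i) (h i).
set sT := \sum_(i < K.+1) dotv (tail_from A e i.+1) (tail_from A e i.+1).
set X := \sum_(i < K.+1) (_ + _).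
set t0 := dotv (tail_from A e 0) _.
set m := dotv mu mu.
have := multiplier_bound; rewrite -/m.
set sL := \sum_i _; set sA := \sum_(i < K.+1) _ => mE.
set tK := dotv (tail_from A e K.+1) (tail_from A e K.+1).
set e0 := dotv (e ord0) (e ord0).
have sTW : sT <= \sum_i W i / 2 * dotv (A i *m e i) (A i *m e i).
  exact: (@sum_tail_le R K.+2 p (fun i => A i *m e i)).
have PE : gamma * (3 / 2 + delta) * sT + delta * kappa / gamma * sL
    - gamma / 2 * tK - delta * kappa / gamma * (L ord0 ^+ 2 * e0) <= P.
  apply: (le_trans _ (ler_sum _ (fun i _ => block_bound i))).
  rewrite !sumrB big_split /= -!mulr_sumr -!big_mkcond !big_pred1_eq /=.
  rewrite (tail_fromS A e ord_max) tail_from_out subr0 !lerD2r ler_pM2l //.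
  by rewrite mulr_gt0 // addr_gt0.
(* Chosen so that [gamma * beta * lmin * e0] equals the deferred Lipschitz term of the first block;
   [lmin * e0] is at most [|T_1 - T_2|^2]. *)
pose beta := delta * kappa * L ord0 ^+ 2 / (lmin * gamma ^+ 2).
have g2 : 0 < gamma ^+ 2 by rewrite exprn_gt0.
have dk0 : 0 < delta * kappa by rewrite mulr_gt0.
have dk : 0 <= delta * kappa by exact: ltW.
have lmin0 : lmin != 0 by rewrite gt_eqF.
have a0 : 0 <= delta * kappa * lmax (inord 0) by rewrite mulr_ge0.
have b0 : 0 <= beta.
  apply: divr_ge0; first by rewrite mulr_ge0 ?sqr_ge0.
  by rewrite ltW // mulr_gt0.
have inord0 : inord 0 = ord0 :> 'I_K.+2 by apply: val_inj; rewrite /= inordK.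
have N3 : 3 <= N by rewrite ler_nat !ltnS.
(* Dividing [delta_first] by [4 gamma^2] gives this bound with [N - 1] in place of 2, hence
   [3 <= N]. *)
have ab : 2 * (delta * kappa * lmax (inord 0)) + beta <= 1 / 4.
  rewrite inord0 -(ler_pM2r g2) mulrDl.
  have -> : beta * gamma ^+ 2 = delta * kappa * L ord0 ^+ 2 * lmin^-1.
    by rewrite /beta; field; rewrite g0 lmin0.
  have := delta_first.
  have : 0 <= (N - 3) * (delta * kappa * lmax ord0 * gamma ^+ 2).
    by rewrite mulr_ge0 ?mulr_ge0 ?subr_ge0 // ltW.
  lra.
have ai i : (i <= K)%N -> delta * kappa * lmax (inord i) <= 1 / 4.
  move=> iK; have := delta_max (i := inord i).
  by rewrite inordK ?ltnS // => [/(_ iK)|]; [lra | exact: leqW].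
have := cross_terms_le (tail_from A e) (fun i => d i) ai a0 b0 ab.
rewrite -/X -/t0 -/sT -/tK.
have -> : \sum_(i < K.+1) delta * kappa * lmax (inord i) * dotv (d i) (d i)
    = delta * kappa * sA.
  by rewrite mulr_sumr; apply: eq_bigr => i _; rewrite mulrA.
have := A0_ge (e ord0); rewrite (tail_fromS A e ord0) /= -/e0.
set q := dotv (tail_from A e 0 - tail_from A e 1) _ => qe cross.
have qb : delta * kappa / gamma * (L ord0 ^+ 2 * e0) <= gamma * (beta * q).
  have -> : delta * kappa / gamma * (L ord0 ^+ 2 * e0) =
      gamma * (beta * (lmin * e0)).
    by rewrite /beta; field; rewrite g0 lmin0.
  by rewrite ler_pM2l // ler_wpM2l.
(* The extra [delta |mu|^2 / (2 gamma)] splits into the Lipschitz part reserved in [PE] and the [d]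
   part carried by the coefficients [alpha]. *)
have mb : delta * ((2 * gamma)^-1 * m) <=
    delta * kappa / gamma * sL + gamma * (delta * kappa * sA).
  have -> : delta * kappa / gamma * sL + gamma * (delta * kappa * sA) =
      delta * ((2 * gamma)^-1 * (2 * kappa * (sL + gamma ^+ 2 * sA))).
    by field.
  by rewrite ler_pM2l // ler_pM2l ?invr_gt0 ?mulr_gt0.
have tK0 : 0 <= gamma * tK by rewrite mulr_ge0 ?dotv_ge0 // ltW.
have := ler_wpM2l (ltW gamma_gt0) cross.
lra.
Qed.

End OneStep.

(** * Positivity and finiteness of [delta6] in the extended reals *)

Section Constants.
Context {R : realType}.

Lemma divee_gt0 (a b : R) : 0 < a -> 0 <= b -> (0 < a%:E / b%:E)%E.
Proof.
move=> a0 b0; rewrite inver; case: eqP => [_|/eqP b1].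
  by rewrite gt0_muley ?lte_fin.
by rewrite -EFinM lte_fin divr_gt0 // lt_def b1.
Qed.

Lemma lee_pdiv (t a b : R) : 0 <= a -> 0 <= b ->
  (t%:E <= a%:E / b%:E)%E -> t * b <= a.
Proof.
move=> a0 b0; rewrite inver; case: eqP => [-> _|/eqP b1]; first by rewrite mulr0.
by rewrite -EFinM lee_fin ler_pdivlMr // lt_def b1.
Qed.

Lemma lte_pdiv (t a b : R) : 0 < a -> 0 <= b ->
  (t%:E < a%:E / b%:E)%E -> t * b < a.
Proof.
move=> a0 b0; rewrite inver; case: eqP => [-> _|/eqP b1]; first by rewrite mulr0.
by rewrite -EFinM lte_fin ltr_pdivlMr // lt_def b1.
Qed.

Context {N p : nat} {n : 'I_N -> nat}.
Variables (hN : (3 <= N)%N) (A : forall i, 'M[R]_(p, n i)).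
Variables (sigma L : 'I_N -> R) (gamma kappa : R).
Local Notation lmax i := (lambda_max ((A i)^T *m A i)).
Local Notation fst_ := (first_block hN).
Local Notation lst := (last_block hN).

Hypothesis n_gt0 : forall i, (0 < n i)%N.
Hypothesis sigma_gt0 : forall i : 'I_N, (0 < i)%N -> 0 < sigma i.
Hypothesis kappa_gt0 : 0 < kappa.
Hypothesis gamma_gt0 : 0 < gamma.
Hypothesis lmax_first : 0 < lmax fst_.
Hypothesis lmin_first : 0 < lambda_min ((A fst_)^T *m A fst_).
Hypothesis gamma_lt : (gamma%:E < gamma_bound hN A sigma)%E.

Let lmax_ge0 i : 0 <= lmax i.
Proof. exact: lambda_max_gram_ge0. Qed.

Let N3 : 3 <= N%:R :> R.
Proof. by rewrite ler_nat. Qed.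

(** The bound on [gamma], cleared of its denominator and multiplied by [gamma], is the positivity of
    the numerators of [delta3]; the last ratio serves [delta5] likewise. *)
Let num_mid_gt0 (i : 'I_N) : (0 < i)%N -> (i.+1 < N)%N ->
  0 < 4 * sigma i * gamma - 3 * gamma ^+ 2 * block_weight i * lmax i.
Proof.
move=> i0 iN; move: gamma_lt; rewrite /gamma_bound /= lt_min => /andP[+ _].
have iP : (0 < i)%N && (i.+1 < N)%N by rewrite i0 iN.
move=> /bigmin_gtP[_ /(_ i iP)] /lte_pdiv h.
have w0 := block_weight_ge0 (R := R) i.
have : gamma * (3 * block_weight i * lmax i) < 4 * sigma i.
  apply: h; first by rewrite mulr_gt0 // sigma_gt0.
  exact: mulr_ge0 (mulr_ge0 (ler0n _ 3) w0) (lmax_ge0 i).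
rewrite -(ltr_pM2l gamma_gt0); lra.
Qed.

Let num_last_gt0 :
  0 < 4 * sigma lst * gamma
      - (3 * N%:R ^+ 2 - 3 * N%:R - 2) * gamma ^+ 2 * lmax lst.
Proof.
have l0 : (0 < lst)%N by rewrite /=; lia.
have c0 : 0 <= 3 * N%:R ^+ 2 - 3 * N%:R - 2 :> R by move: N3; nra.
move: gamma_lt; rewrite /gamma_bound /= lt_min => /andP[_ /lte_pdiv h].
have {}h := h (mulr_gt0 (ltr0n _ 4) (sigma_gt0 l0)) (mulr_ge0 c0 (lmax_ge0 _)).
move: h; rewrite -(ltr_pM2l gamma_gt0); lra.
Qed.

Let den_ge0 (i : 'I_N) : 0 <= 4 * kappa * L i ^+ 2.
Proof. by rewrite mulr_ge0 ?sqr_ge0 // mulr_ge0 // ltW. Qed.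

(** Strictness makes the first quotient finite, and with it the minimum [delta6], even when other
    quotients are [+oo]. *)
Let den_first_gt0 :
  0 < 4 * kappa * gamma ^+ 2 * (N%:R - 1) * lmax fst_
      + 4 * kappa * L fst_ ^+ 2 * (lambda_min ((A fst_)^T *m A fst_))^-1.
Proof.
have N1 : 0 < N%:R - 1 :> R by move: N3; lra.
rewrite ltr_pwDl //; last by rewrite mulr_ge0 // invr_ge0 ltW.
rewrite (mulr_gt0 _ lmax_first) // (mulr_gt0 _ N1) //.
by rewrite mulr_gt0 ?exprn_gt0 ?mulr_gt0.
Qed.

Let den_mid_ge0 (i : 'I_N) :
  0 <= 2 * gamma ^+ 2 * block_weight i * lmax i + 4 * kappa * L i ^+ 2.
Proof.
rewrite addr_ge0 // mulr_ge0 // mulr_ge0 ?block_weight_ge0 // mulr_ge0 //.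
exact: sqr_ge0.
Qed.

Let den_max_ge0 (i : 'I_N) : 0 <= 4 * kappa * lmax i.
Proof. by rewrite mulr_ge0 // mulr_ge0 // ltW. Qed.

Let den_last_ge0 :
  0 <= 2 * gamma ^+ 2 * N%:R * (N%:R - 1) * lmax lst + 4 * kappa * L lst ^+ 2.
Proof.
have N1 : 0 <= N%:R - 1 :> R by move: N3; lra.
rewrite addr_ge0 // mulr_ge0 // mulr_ge0 // mulr_ge0 // mulr_ge0 //.
exact: sqr_ge0.
Qed.

Lemma delta6_gt0 : (0 < delta6 hN A sigma L gamma kappa)%E.
Proof.
rewrite /delta6 /delta3 /delta4 /delta5 /= !lt_min; apply/and4P; split.
- by apply: divee_gt0; rewrite ?exprn_gt0 // ltW.
- by apply: lt_bigmin => // i /andP[i0 iN]; apply: divee_gt0;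
    [exact: num_mid_gt0 | exact: den_mid_ge0].
- by apply: lt_bigmin => // i _; apply: divee_gt0.
- exact: divee_gt0.
Qed.

Lemma delta6_fin_num : delta6 hN A sigma L gamma kappa \is a fin_num.
Proof.
rewrite gt0_fin_numE ?delta6_gt0 // /delta6 gt_min.
by rewrite inver gt_eqF // -EFinM ltry.
Qed.

Local Notation delta := (fine (delta6 hN A sigma L gamma kappa)).

Lemma fine_delta6_gt0 : 0 < delta.
Proof.
rewrite fine_gt0 // delta6_gt0 -ge0_fin_numE ?delta6_fin_num //.
by rewrite ltW ?delta6_gt0.
Qed.

Lemma delta6_bounds :
  [/\ delta * (4 * kappa * gamma ^+ 2 * (N%:R - 1) * lmax fst_
       + 4 * kappa * L fst_ ^+ 2 * (lambda_min ((A fst_)^T *m A fst_))^-1)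
     <= gamma ^+ 2,
   forall i : 'I_N, (0 < i)%N -> (i.+1 < N)%N ->
     delta * (2 * gamma ^+ 2 * block_weight i * lmax i + 4 * kappa * L i ^+ 2)
     <= 4 * sigma i * gamma - 3 * gamma ^+ 2 * block_weight i * lmax i,
   forall i : 'I_N, (i.+1 < N)%N -> delta * (4 * kappa * lmax i) <= 1 &
   delta * (2 * gamma ^+ 2 * N%:R * (N%:R - 1) * lmax lst
            + 4 * kappa * L lst ^+ 2)
   <= 4 * sigma lst * gamma
      - (3 * N%:R ^+ 2 - 3 * N%:R - 2) * gamma ^+ 2 * lmax lst].
Proof.
have : (delta%:E <= delta6 hN A sigma L gamma kappa)%E.
  by rewrite fineK ?delta6_fin_num.
rewrite {2}/delta6 /delta3 /delta4 /delta5 /= !le_min => /and4P[d1 d3 d4 d5].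
split=> [|i i0 iN|i iN|].
- by apply: (lee_pdiv _ _ d1); rewrite ?sqr_ge0 // ltW.
- have iP : (0 < i)%N && (i.+1 < N)%N by rewrite i0 iN.
  have /bigmin_geP[_ /(_ i iP)] := d3.
  apply: lee_pdiv; last exact: den_mid_ge0.
  by rewrite ltW // num_mid_gt0.
- by have /bigmin_geP[_ /(_ i iN)] := d4; exact: lee_pdiv.
- by apply: (lee_pdiv _ _ d5); rewrite // ltW.
Qed.

End Constants.

(** * Optimality conditions of the block updates *)

Section BlockUpdate.
Context {R : realType} {N p : nat} {n : 'I_N -> nat}.
Variables (A : forall i, 'M[R]_(p, n i)) (b : 'cV[R]_p).

Lemma aug_lagrangian_fin (f : forall i, 'cV[R]_(n i) -> \bar R)
    (F : forall i, 'cV[R]_(n i) -> R) gamma z lam :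
  (forall i y, f i y = (F i y)%:E) ->
  aug_lagrangian A b f gamma z lam =
  (\sum_i F i (z i) + (- dotv lam (residual A b z)
     + gamma / 2 * enorm (residual A b z) ^+ 2))%:E.
Proof.
by move=> fE; rewrite /aug_lagrangian (eq_bigr _ (fun i _ => fE i (z i))) sumEFin.
Qed.

Lemma residual_dfwith (z : forall i, 'cV[R]_(n i)) i y :
  residual A b (dfwith z i y) =
  (\sum_(j < N | j != i) A j *m z j - b) + A i *m y.
Proof.
rewrite /residual (bigD1 i) //= dfwithin -addrA [LHS]addrC; congr (_ - _ + _).
apply: eq_bigr => j ji.
by rewrite dfwithout // eq_sym.
Qed.

Lemma sum_dfwith (F : forall i, 'cV[R]_(n i) -> R) (z : forall i, 'cV[R]_(n i))
    i y :
  \sum_j F j (dfwith z i y j) = F i y + \sum_(j < N | j != i) F j (z j).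
Proof.
rewrite (bigD1 i) //= dfwithin; congr (_ + _); apply: eq_bigr => j ji.
by rewrite dfwithout // eq_sym.
Qed.

(** As a function of block [i] alone, the augmented Lagrangian is [F i] plus a quadratic in an
    affine residual, up to a constant, so [subgradient_quadratic_min] applies. *)
Lemma block_subgradient (f : forall i, 'cV[R]_(n i) -> \bar R)
    (F : forall i, 'cV[R]_(n i) -> R) gamma (z : forall i, 'cV[R]_(n i)) i x lam :
  (forall i y, f i y = (F i y)%:E) -> convex_function setT (F i) ->
  0 <= gamma ->
  (forall y, (aug_lagrangian A b f gamma (dfwith z i x) lam
                <= aug_lagrangian A b f gamma (dfwith z i y) lam)%E) ->
  forall y, F i x +
      dotv ((A i)^T *m (lam - gamma *: residual A b (dfwith z i x))) (y - x)
    <= F i y.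
Proof.
move=> fE cF gamma0 xmin; rewrite residual_dfwith.
apply: subgradient_quadratic_min => // y.
have := xmin y; rewrite !(aug_lagrangian_fin _ _ _ fE) lee_fin !sum_dfwith.
rewrite !residual_dfwith; lra.
Qed.

(** The mixed iterate differs from the new one only in the blocks after [i]; this is where [d_i]
    comes from. *)
Lemma residual_admm_point (x x' : forall i, 'cV[R]_(n i)) (i : 'I_N) :
  residual A b (dfwith (admm_point x' x i) i (x' i)) =
  residual A b x' + (tail_from A x i.+1 - tail_from A x' i.+1).
Proof.
rewrite /residual /tail_from -sumrB [X in _ - b + X]big_mkcond addrAC -big_split /=.
congr (_ - b); apply: eq_bigr => j _.
have [ij|ji|/val_inj ->] := ltngtP i j.
- rewrite dfwithout; last by rewrite -val_eqE (ltn_eqF ij).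
  by rewrite /admm_point ltnNge (ltnW ij) addrC subrK.
- rewrite dfwithout; last by rewrite -val_eqE (gtn_eqF ji).
  by rewrite /admm_point ji addr0.
- by rewrite dfwithin addr0.
Qed.

End BlockUpdate.

(** * Residual errors and the stacked matrix of all blocks *)

Lemma optimal_residual (R : realType) (N p : nat) (n : 'I_N -> nat)
    (A : forall i, 'M[R]_(p, n i)) b f x xs lams :
  primal_dual_optimal A b f xs lams ->
  residual A b x = tail_from A (fun i => x i - xs i) 0.
Proof.
by move=> [_ Axs]; rewrite /residual -Axs tail_fromB.
Qed.

Lemma full_matrix_mul (R : realType) (N p : nat) (n : 'I_N -> nat)
    (A : forall i, 'M[R]_(p, n i)) (e : forall i, 'cV[R]_(n i)) :
  full_matrix A *m (\mxcol_i e i) = \sum_i A i *m e i.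
Proof. by rewrite /full_matrix mul_mxrow_mxcol. Qed.

Lemma dotv_full_matrix_tr (R : realType) (N p : nat) (n : 'I_N -> nat)
    (A : forall i, 'M[R]_(p, n i)) (v : 'cV[R]_p) :
  dotv ((full_matrix A)^T *m v) ((full_matrix A)^T *m v) =
  \sum_i dotv ((A i)^T *m v) ((A i)^T *m v).
Proof.
rewrite -dotv_gram trmxK /full_matrix tr_mxrow mul_mxrow_mxcol mulmx_suml.
rewrite dotvC dotv_suml; apply: eq_bigr => i _.
by rewrite dotvC -[in LHS](trmxK (A i)) trmxK -dotv_gram trmxK.
Qed.

(** * Contraction of the ADMM errors and Q-linear convergence *)

Theorem theorem3p3 (R : realType) (N p : nat) (n : 'I_N -> nat)
    (A : forall i : 'I_N, 'M[R]_(p, n i)) (b : 'cV[R]_p)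
    (X : forall i : 'I_N, set 'cV[R]_(n i))
    (ftilde : forall i : 'I_N, 'cV[R]_(n i) -> R)
    (sigma L : 'I_N -> R) (gamma kappa : R)
    (xs : forall i : 'I_N, 'cV[R]_(n i)) (lams : 'cV[R]_p)
    (x : nat -> forall i : 'I_N, 'cV[R]_(n i)) (lam : nat -> 'cV[R]_p)
    (f := fun i : 'I_N => restricted (ftilde i) (X i))
    (hN : (3 <= N)%N)
    (n_gt0 : forall i, (0 < n i)%N)
    (X_closed : forall i, closed (X i))
    (X_convex : forall i, convex_set (X i))
    (ftilde_convex : forall i, convex_function setT (ftilde i))
    (ftilde_closed : forall i, closed_function (ftilde i))
    (sigma_gt0 : forall i : 'I_N, (0 < i)%N -> 0 < sigma i)
    (f_sigma : forall i : 'I_N, (0 < i)%N ->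
       convexity_parameter (X i) (f i) (sigma i))
    (f_L : forall i, lipschitz_gradient (f i) (L i))
    (A1_full_col_rank : \rank (A (first_block hN)) = n (first_block hN))
    (kappaP : is_kappa (full_matrix A) kappa)
    (opt : primal_dual_optimal A b f xs lams)
    (gamma_gt0 : 0 < gamma)
    (gamma_lt : (gamma%:E < gamma_bound hN A sigma)%E)
    (admm : admm_sequence A b f gamma x lam)
    (* The component of [lam k] in the kernel of A^T never changes, so without full
       row rank [lam k] can only approach [lams] if it starts with the same one. *)
    (lam0_range : \rank (full_matrix A) <> p ->
       exists w, lams - lam 0%N = full_matrix A *m w)
    (delta := fine (delta6 hN A sigma L gamma kappa)) :
  [/\ 0 < delta,
      forall k,
        (1 + delta) *
          (gamma * \sum_(i < N.-1) enorm (\sum_(j < N | (i < j)%N)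
                                      A j *m (xs j - x k.+1 j)) ^+ 2
           + (2 * gamma)^-1 * enorm (lams - lam k.+1) ^+ 2)
        <= gamma * \sum_(i < N.-1) enorm (\sum_(j < N | (i < j)%N)
                                      A j *m (xs j - x k j)) ^+ 2
           + (2 * gamma)^-1 * enorm (lams - lam k) ^+ 2 &
      Q_linear (@admm_norm R N p gamma)
        (fun k => (tail_sum A (x k), lam k)) (tail_sum A xs, lams)].

Proof.
destruct N as [|[|K]]; [by [] | by [] |].
(* The Lipschitz hypothesis makes all values of [f i] finite, so every point is feasible and [f i]
   coincides with [ftilde i]. *)
have XT i y : X i y /\ f i y = (ftilde i y)%:E.
  by apply: restricted_fin_num; have [fin _ _] := f_L i; exact: fin.
have fE i y : f i y = (ftilde i y)%:E by have [] := XT i y.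
have finE i : fine \o f i = ftilde i by apply/funext => y /=; rewrite fE.
have subE i y g : (forall z, ftilde i y + dotv g (z - y) <= ftilde i z) ->
    subdifferential (f i) y g.
  move=> sub; split; first by rewrite fE.
  by move=> z; rewrite !fE -EFinD lee_fin; exact: sub.
have gradE i y g : (forall z, ftilde i y + dotv g (z - y) <= ftilde i z) ->
    gradient (fine \o f i) y = g.
  have [_ fd _] := f_L i => sub; apply: subgradient_gradient; first exact: fd.
  by rewrite finE.
have sub_opt i z :
    ftilde i (xs i) + dotv ((A i)^T *m lams) (z - xs i) <= ftilde i z.
  by have [_ /(_ z)] := opt.1 i; rewrite !fE -EFinD lee_fin.
pose e k i := x k i - xs i.
(* The multiplier update absorbs the new residual, turning [lam k] into [lam k.+1] and leaving the
   tail difference. *)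
pose g k i := (A i)^T *m (lam k.+1
  - gamma *: (tail_from A (e k) i.+1 - tail_from A (e k.+1) i.+1)).
have lamS k : lam k.+1 = lam k - gamma *: tail_from A (e k.+1) 0.
  by rewrite (admm k).2 (optimal_residual _ opt).
have sub_admm k i z :
    ftilde i (x k.+1 i) + dotv (g k i) (z - x k.+1 i) <= ftilde i z.
  have := block_subgradient fE (ftilde_convex i) (ltW gamma_gt0) ((admm k).1 i) z.
  rewrite residual_admm_point (optimal_residual _ opt) scalerDr opprD addrA -lamS.
  by rewrite /g /e !tail_fromB opprB addrA subrK.
have firstE : first_block hN = ord0 by exact: val_inj.
have lastE : last_block hN = ord_max by exact: val_inj.
have A1_inj (u : 'cV_(n (first_block hN))) : A (first_block hN) *m u = 0 -> u = 0.
  move/(congr1 trmx)/eqP; rewrite trmx_mul trmx0 mulmx_free_eq0.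
    by rewrite trmx_eq0 => /eqP.
  by rewrite /row_free mxrank_tr A1_full_col_rank.
have rankA : (0 < \rank (full_matrix A))%N.
  rewrite lt0n mxrank_eq0; apply/eqP => A0.
  have := n_gt0 (first_block hN); rewrite -A1_full_col_rank.
  suff -> : A (first_block hN) = 0 by rewrite mxrank0.
  rewrite -[LHS](mxrowK A) -/(full_matrix A) A0.
  by apply/matrixP => i j; rewrite !mxE.
have [kappa_gt0 mu_bound] := is_kappa_bound rankA kappaP.
have lmax0 := lambda_max_gram_gt0 (n_gt0 _) A1_inj.
have lmin0 := lambda_min_gram_gt0 (n_gt0 _) A1_inj.
have delta_gt0 : 0 < delta by exact: fine_delta6_gt0.
(* Each update of the multiplier adds an element of the range of the stacked matrix, so the range
   condition propagates from [k = 0]. *)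
have mu_range k : \rank (full_matrix A) <> p ->
    exists w, lam k - lams = full_matrix A *m w.
  move=> rp; elim: k => [|k [w IH]].
    have [w lw] := lam0_range rp; exists (- w).
    by rewrite mulmxN -lw opprB.
  exists (w - gamma *: \mxcol_i e k.+1 i).
  by rewrite mulmxBr -IH -scalemxAr full_matrix_mul lamS addrAC.
pose V k := gamma * \sum_(i < K.+1)
    dotv (tail_from A (e k) i.+1) (tail_from A (e k) i.+1)
  + (2 * gamma)^-1 * dotv (lam k - lams) (lam k - lams).
have VE k : gamma * \sum_(i < K.+1) enorm (\sum_(j < K.+2 | (i < j)%N)
      A j *m (xs j - x k j)) ^+ 2
    + (2 * gamma)^-1 * enorm (lams - lam k) ^+ 2 = V k.
  rewrite /V -enormN opprB sqr_enorm; congr (_ * _ + _).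
  apply: eq_bigr => i _; rewrite -enormN sqr_enorm -sumrN.
  suff -> : \sum_(j < K.+2 | (i < j)%N) - (A j *m (xs j - x k j)) =
    tail_from A (e k) i.+1 by [].
  by apply: eq_bigr => j _; rewrite -mulmxN opprB.
have contract k : (1 + delta) * V k.+1 <= V k.
  have [d1 d3 d4 d5] := delta6_bounds L n_gt0 sigma_gt0 kappa_gt0 gamma_gt0
    lmax0 lmin0 gamma_lt.
  rewrite firstE in d1 lmin0; rewrite lastE in d5.
  pose h i := g k i - (A i)^T *m lams.
  have hE i : h i = (A i)^T *m (lam k.+1 - lams
      - gamma *: (tail_from A (e k) i.+1 - tail_from A (e k.+1) i.+1)).
    by rewrite /h /g -mulmxBr addrAC.
  have muE : lam k - lams = lam k.+1 - lams + gamma *: tail_from A (e k.+1) 0.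
    by rewrite lamS addrAC subrK.
  rewrite {2}/V muE.
  apply: (contraction_step (lmax := fun i => lambda_max ((A i)^T *m A i))
    _ _ _ _ lmin0 _ _ _ _ hE _ _ _ _ d1 d3 d4 d5) => //.
  - by move=> i; exact: lambda_max_gram_ge0.
  - by move=> i u; exact: dotv_mulmx_le.
  - by move=> i v; exact: dotv_trmulmx_le.
  - by move=> u; exact: dotv_mulmx_ge.
  (* Adding the two subgradient inequalities gives monotonicity for the first block, for which no
     strong convexity is assumed. *)
  - have := sub_admm k ord0 (xs ord0); have := sub_opt ord0 (x k.+1 ord0).
    rewrite -/(e k.+1 ord0) -[xs ord0 - _]opprB -/(e k.+1 ord0) dotvNr.
    rewrite [dotv _ (h ord0)]dotvC /h dotvDl dotvNl; lra.
  - move=> i i0.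
    have := f_sigma i i0 _ _ _ _ (XT _ _).1 (XT _ _).1
      (subE _ _ _ (sub_admm k i)) (subE _ _ _ (sub_opt i)).
    by rewrite sqr_enorm.
  - move=> i; have [_ _ /(_ (x k.+1 i) (xs i))] := f_L i.
    rewrite (gradE _ _ _ (sub_admm k i)) (gradE _ _ _ (sub_opt i)) => lip.
    rewrite -!sqr_enorm -exprMn ler_pXn2r ?nnegrE ?sqrtr_ge0 //.
    by apply: le_trans lip; exact: sqrtr_ge0.
  - by rewrite -dotv_full_matrix_tr; apply: mu_bound; exact: mu_range.
split=> // [k|]; first by rewrite !VE.
have d1 : 0 < 1 + delta by rewrite addr_gt0.
(* The contraction concerns the squared norm, hence the square root in the rate. *)
exists (Num.sqrt (1 + delta)^-1).
  by rewrite sqrtr_gt0 invr_gt0 d1 /= -[ltRHS]sqrtr1 ltr_sqrt // invf_lt1 // ltrDl.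
move=> k; rewrite -sqrtrM ?invr_ge0 ?(ltW d1) //.
have VE' m : admm_sqnorm gamma
    ((tail_sum A (x m), lam m) - (tail_sum A xs, lams)) = V m.
  rewrite /admm_sqnorm /V sqr_enorm; congr (_ * _ + _).
  by apply: eq_bigr => i _; rewrite sqr_enorm tail_fromB.
have V_ge0 : 0 <= V k.
  rewrite addr_ge0 // mulr_ge0 ?dotv_ge0 ?invr_ge0 ?(ltW gamma_gt0) //.
    by apply: sumr_ge0 => i _; exact: dotv_ge0.
  by rewrite mulr_ge0 // ltW.
rewrite /admm_norm !VE' ler_sqrt ?mulr_ge0 ?invr_ge0 ?(ltW d1) //.
by rewrite -ler_pdivrMl ?invr_gt0 // invrK.
Qed.
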